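(* Let $\Phi$ be a multiplicative distance function and $N\ge 1$ an integer. Then there is $\epsilon>0$ such that $f_N(\Phi;\xi)=h_N(\Phi;\xi)=0$ for all $0\le\xi<\epsilon$; moreover, as $\xi\to\infty$, $f_N(\Phi;\xi)=O(\xi^N)$ and $h_N(\Phi;\xi)=O(\xi^{2N})$, and \[ \lim_{\xi\to\infty}\frac{f_N(\Phi;\xi)}{\xi^N}=\lambda_N(\mathcal{U}_{N-1}(\Phi)),\qquad \lim_{\xi\to\infty}\frac{h_N(\Phi;\xi)}{\xi^{2N}}=\lambda_{2N}(\mathcal{V}_{N-1}(\Phi)). \]
   Context: A multiplicative distance function is a function $\Phi:\mathbb{C}[x]\to[0,\infty)$ which is continuous on every finite-dimensional subspace of $\mathbb{C}[x]$ (as a function of coefficient vectors), satisfies $\Phi(f)=0$ iff $f=0$, $\Phi(wf)=|w|\Phi(f)$ for $w\in\mathbb{C}$, and $\Phi(fg)=\Phi(f)\Phi(g)$. For $\mathbf{a}\in\mathbb{C}^{M+1}$ write $\Phi(\mathbf{a})=\Phi\big(\sum_{n=1}^{M+1}a_nx^{M+1-n}\big)$ and set $\mathcal{U}_M(\Phi)=\{\mathbf{a}\in\mathbb{R}^{M+1}:\Phi(\mathbf{a})\le1\}$, $\mathcal{V}_M(\Phi)=\{\mathbf{a}\in\mathbb{C}^{M+1}:\Phi(\mathbf{a})\le1\}$. The monic restriction is $\widetilde\Phi(\mathbf{b})=\Phi\big(x^N+\sum_{n=1}^Nb_nx^{N-n}\big)$ for $\mathbf{b}\in\mathbb{C}^N$.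 With $\lambda_N$, $\lambda_{2N}$ Lebesgue measure on $\mathbb{R}^N$, $\mathbb{C}^N$, define $f_N(\Phi;\xi)=\lambda_N\{\mathbf{b}\in\mathbb{R}^N:\widetilde\Phi(\mathbf{b})\le\xi\}$ and $h_N(\Phi;\xi)=\lambda_{2N}\{\mathbf{b}\in\mathbb{C}^N:\widetilde\Phi(\mathbf{b})\le\xi\}$ for $\xi\ge0$. *)

(* Defs.v *)
From HB Require Import structures.
From mathcomp Require Import all_boot all_order all_algebra.
From mathcomp Require Import complex.
From mathcomp Require Import all_classical all_reals all_analysis.
Set Implicit Arguments.
Unset Strict Implicit.
Unset Printing Implicit Defensive.
Import Order.TTheory GRing.Theory Num.Theory.
Import numFieldNormedType.Exports.
Local Open Scope classical_set_scope.
Local Open Scope ring_scope.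
Local Open Scope complex_scope.

(* The n-th power, on n.-tuple T with the product sigma-algebra, of a
   sigma-finite measure: the library's binary products are iterated and
   transported along (x, t) |-> x :: t. *)
Section cons_measure.
Context d (T : measurableType d) (R : realType).
Variables (mu : {sigma_finite_measure set T -> \bar R}) (n : nat).
Variable m : {sigma_finite_measure set (n.-tuple T) -> \bar R}.

Definition pair_cons (p : T * n.-tuple T) : n.+1.-tuple T :=
  [tuple of p.1 :: p.2].

Lemma measurable_pair_cons : measurable_fun [set: T * n.-tuple T] pair_cons.
Proof. exact: measurable_cons. Qed.

Definition cons_measure : set (n.+1.-tuple T) -> \bar R :=
  pushforward (mu \x m)%E pair_cons.

Let measurable_preimage A :
  measurable A -> measurable (pair_cons @^-1` A).
Proof.
by move=> mA; rewrite -[X in measurable X]setTI; exact: measurable_pair_cons.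
Qed.

Let cons_measure0 : cons_measure set0 = 0%E.
Proof. by rewrite /cons_measure /pushforward preimage_set0; exact: measure0. Qed.

Let cons_measure_ge0 A : (0 <= cons_measure A)%E.
Proof. exact: (measure_ge0 (mu \x m)%E). Qed.

Let cons_measure_sigma_additive : semi_sigma_additive cons_measure.
Proof.
move=> F mF tF mUF; rewrite /cons_measure /pushforward preimage_bigcup.
apply: measure_semi_sigma_additive.
- by move=> k; exact: measurable_preimage.
- apply/trivIsetP => i j _ _ ij; rewrite -preimage_setI.
  by move/trivIsetP : tF => /(_ _ _ _ _ ij) -> //; rewrite preimage_set0.
- by rewrite -preimage_bigcup; exact: measurable_preimage.
Qed.

HB.instance Definition _ := isMeasure.Build _ _ _ cons_measure
  cons_measure0 cons_measure_ge0 cons_measure_sigma_additive.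

Let cons_measure_sigma_finite : sigma_finite setT cons_measure.
Proof.
have /sigma_finiteP[F [TF ndF Foo]] := sigma_finiteT mu.
have /sigma_finiteP[G [TG ndG Goo]] := sigma_finiteT m.
pose g (t : n.+1.-tuple T) := (thead t, [tuple of behead t] : n.-tuple T).
have mg : measurable_fun setT g.
  apply/measurable_fun_pair; first exact: measurable_tnth.
  exact: measurable_behead.
have gK : g \o pair_cons = id.
  by apply/funext => -[x t]; congr pair; apply: val_inj.
exists (fun k => g @^-1` (F k `*` G k)).
  apply/seteqP; split => // t _.
  have [i _ Fi] : (\bigcup_i F i) (g t).1 by rewrite -TF.
  have [j _ Gj] : (\bigcup_i G i) (g t).2 by rewrite -TG.
  exists (maxn i j) => //; split => /=.
  - by move: Fi; exact/subsetPset/ndF/leq_maxl.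
  - by move: Gj; exact/subsetPset/ndG/leq_maxr.
move=> k; have [mF Fk] := Foo k; have [mG Gk] := Goo k; split.
  by rewrite -[X in measurable X]setTI; apply: mg => //; exact: measurableX.
rewrite /cons_measure /pushforward -comp_preimage gK preimage_id.
by rewrite product_measure1E// lte_mul_pinfty// ge0_fin_numE.
Qed.

HB.instance Definition _ := Measure_isSigmaFinite.Build _ _ _ cons_measure
  cons_measure_sigma_finite.

End cons_measure.

Section tuple_measure.
Context d (T : measurableType d) (R : realType).
Variable mu : {sigma_finite_measure set T -> \bar R}.

Fixpoint tuple_measure n : {sigma_finite_measure set (n.-tuple T) -> \bar R} :=
  match n with
  | 0 => \d_ ([tuple] : 0.-tuple T)
  | n'.+1 => cons_measure mu (tuple_measure n')
  end.

Lemma tuple_measure_box n (A : 'I_n -> set T) :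
  (forall i, measurable (A i)) ->
  tuple_measure n [set t | forall i, A i (tnth t i)] =
  (\prod_(i < n) mu (A i))%E.
Proof.
elim: n A => [|n IH] A mA.
  by rewrite big_ord0 /= diracE mem_set// => -[].
rewrite big_ord_recl -(IH (fun i => A (lift ord0 i)))//=.
rewrite /cons_measure /pushforward -product_measure1E//; last first.
  rewrite [X in measurable X](_ : _ = \bigcap_(i in [set: 'I_n])
      ((fun t : n.-tuple T => tnth t i) @^-1` A (lift ord0 i))).
    apply: fin_bigcap_measurable => [|i _]; first exact: finite_finset.
    by rewrite -[X in measurable X]setTI; exact: measurable_tnth.
  by apply/seteqP; split => t /= h i; [move=> _|]; exact: h.
congr product_measure1; apply/seteqP; split => -[x t] /=.
- move=> h; split; first exact: (h ord0).
  by move=> i; have := h (lift ord0 i); rewrite /pair_cons tnthS.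
- move=> [h0 h] i; case: (unliftP ord0 i) => [j ->|->//].
  by rewrite /pair_cons tnthS; exact: h.
Qed.

End tuple_measure.

Section lebesgue.
Context {R : realType}.

(* Lebesgue measure on R^n. Only values on Borel sets are meaningful: for an
   arbitrary set this is merely an iterated integral of sections. *)
Definition lebesgue_rV n (A : set 'rV[R]_n) : \bar R :=
  tuple_measure lebesgue_measure n [set t | A (\row_k tnth t k)].

(* Lebesgue measure on C^n, identified with R^(2n) by putting the n real parts
   first and the n imaginary parts last. *)
Definition lebesgue_crV n (A : set 'rV[R[i]]_n) : \bar R :=
  lebesgue_rV
    [set x : 'rV[R]_(n + n) | A (\row_k (lsubmx x 0 k +i* rsubmx x 0 k))].

End lebesgue.

Section distance_function.
Context {R : realType}.

(* Every finite-dimensional subspace of C[x] is the span of a finite family p,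
   on which continuity means continuity in the coefficients c with respect to p
   (spanning families and bases give the same condition). The cast to
   numFieldType is what gives R[i] the topology of its norm. *)
Record mult_distance_function (Phi : {poly R[i]} -> R) : Prop := {
  mdf_ge0 : forall f, 0 <= Phi f;
  mdf_continuous : forall n (p : 'I_n -> {poly R[i]}),
    continuous (fun c : 'rV[(R[i] : numFieldType)]_n =>
      Phi (\sum_(k < n) c 0 k *: p k));
  mdf_eq0 : forall f, Phi f = 0 <-> f = 0;
  mdf_scale : forall (w : R[i]) f, Phi (w *: f) = Normc.normc w * Phi f;
  mdf_mul : forall f g, Phi (f * g) = Phi f * Phi g
}.

(* Coordinates are numbered from 0, hence the shift in the exponents. *)
Definition poly_of_coefs M (a : 'rV[R[i]]_M.+1) : {poly R[i]} :=
  \sum_(n < M.+1) a 0 n *: 'X^(M - n).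

Definition monic_of_coefs N (b : 'rV[R[i]]_N) : {poly R[i]} :=
  'X^N + \sum_(n < N) b 0 n *: 'X^(N - n.+1).

Definition complex_rV n (a : 'rV[R]_n) : 'rV[R[i]]_n :=
  map_mx (real_complex R) a.

Variable Phi : {poly R[i]} -> R.

Definition monic_restr N (b : 'rV[R[i]]_N) : R := Phi (monic_of_coefs b).

Definition star_body_real M : set 'rV[R]_M.+1 :=
  [set a | Phi (poly_of_coefs (complex_rV a)) <= 1].

Definition star_body_complex M : set 'rV[R[i]]_M.+1 :=
  [set a | Phi (poly_of_coefs a) <= 1].

Definition vol_real N (xi : R) : \bar R :=
  lebesgue_rV [set b : 'rV[R]_N | monic_restr (complex_rV b) <= xi].

Definition vol_complex N (xi : R) : \bar R :=
  lebesgue_crV [set b : 'rV[R[i]]_N | monic_restr b <= xi].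

End distance_function.

Arguments star_body_real {R} Phi M.
Arguments star_body_complex {R} Phi M.

(* Main.v *)
(* The coefficients with [Phi <= xi] form, after division by [xi], the sublevel
   set [S_xi] of [a |-> Phi (xi^-1 x^N + a)].  By compactness of the unit sphere
   and homogeneity, [c |v| <= Phi v] for some [c > 0], with [|v|] the largest
   modulus of a coefficient: this makes the volumes vanish for [xi < c] and puts
   all [S_xi] into one cube.  On that cube
   [Phi (xi^-1 x^N + a)] tends to [Phi a] uniformly, so for every [d > 0] the set
   [S_xi] eventually lies between [(1 - d) U] and [(1 + d) U], where [U] is the
   star body, and the scaling of Lebesgue measure squeezes the volume of [S_xi]
   to that of [U].  Only homogeneity under real scalars is used, so the complex
   case is the real one on a real form of twice the dimension. *)
Require Import Defs.
From mathcomp Require Import all_boot all_order all_algebra.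
From mathcomp Require Import complex.
From mathcomp Require Import all_classical all_reals all_analysis.
From mathcomp Require Import measurable_realfun lra.
Import Order.TTheory GRing.Theory Num.Theory.
Import numFieldNormedType.Exports.
Local Open Scope classical_set_scope.
Local Open Scope ring_scope.

(** * Scaling of Lebesgue measure on the line and on its powers *)

(** Lebesgue measure is determined by its values on the intervals []a, b]], and the rescaled
    pushforward [nu] has the right ones: the preimage []a / c, b / c]] has length [(b - a) / c]. *)
Lemma lebesgue_measure_scale {R : realType} (c : R) (A : set (measurableTypeR R)) :
  0 < c -> measurable A ->
  (c%:E * lebesgue_measure (( *%R c : R -> measurableTypeR R) @^-1` A) = lebesgue_measure A)%E.
Proof.
move=> c0 mA.
have c0' := ltW c0.
have mc : measurable_fun setT ( *%R c : measurableTypeR R -> measurableTypeR R).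
  exact: measurable_funM.
pose nu : {measure set _ -> \bar R} :=
  mscale (NngNum c0') (pushforward lebesgue_measure
    ( *%R c : measurableTypeR R -> measurableTypeR R)).
rewrite [RHS](@lebesgue_measure_unique R (nu mc))//.
move=> _ [[a b]] _ <- /=.
rewrite /nu/= /mscale/= /pushforward.
rewrite (_ : _ @^-1` _ = `]a / c, b / c]%classic); last first.
  by apply/seteqP; split => x; rewrite /= !in_itv/= ltr_pdivrMr// ler_pdivlMr// mulrC.
rewrite !lebesgue_measure_itv/= !lte_fin ltr_pM2r ?invr_gt0//.
case: ifPn => _; last by rewrite mule0.
by rewrite -!EFinB -EFinM -mulrBl mulrCA divff ?mulr1// gt_eqF.
Qed.

Definition tuple_scale {R : realType} (c : R) {n} (t : n.-tuple (measurableTypeR R)) :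
  n.-tuple (measurableTypeR R) := [tuple of map ( *%R c) t].

Lemma measurable_tuple_scale {R : realType} (c : R) n :
  measurable_fun setT (@tuple_scale R c n).
Proof.
apply/measurable_fun_tnthP => i.
rewrite (_ : _ \o _ = (fun t => c * tnth t i)); last first.
  by apply/funext => t /=; rewrite tnth_map.
apply: measurable_funM => //; exact: measurable_tnth.
Qed.

(** Induction on the dimension. On a rectangle the first factor contributes [c] and the induction
    hypothesis [c ^+ n]; uniqueness of the product measure does the rest. *)
Lemma tuple_lebesgue_scale {R : realType} (c : R) n (A : set (n.-tuple (measurableTypeR R))) :
  0 < c -> measurable A ->
  ((c ^+ n)%:E * tuple_measure lebesgue_measure n (@tuple_scale R c n @^-1` A)
   = tuple_measure lebesgue_measure n A)%E.
Proof.
move=> c0; elim: n A => [|n IH] A mA.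
  rewrite expr0 mul1e; congr (tuple_measure _ _ _); apply/seteqP.
  by split => t; rewrite /= (tuple0 t) (tuple0 (tuple_scale c _)).
have cn0 : 0 <= c ^+ n.+1 by rewrite exprn_ge0// ltW.
pose phi := (fun p : measurableTypeR R * n.-tuple (measurableTypeR R) =>
     ((c * p.1 : measurableTypeR R), tuple_scale c p.2)).
have mphi : measurable_fun setT phi.
  apply/measurable_fun_pair => /=.
    exact: measurable_funM.
  by apply: measurableT_comp => //; exact: measurable_tuple_scale.
pose nu : {measure set _ -> \bar R} := mscale (NngNum cn0)
  (pushforward (lebesgue_measure \x tuple_measure lebesgue_measure n)%E phi).
have nuE X : nu mphi X = ((c ^+ n.+1)%:E *
   (lebesgue_measure \x tuple_measure lebesgue_measure n) (phi @^-1` X))%E by [].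
have tE B : tuple_measure lebesgue_measure n.+1 B =
  ((lebesgue_measure \x tuple_measure lebesgue_measure n)
    (@pair_cons _ (measurableTypeR R) n @^-1` B))%E by [].
have phiE : (@pair_cons _ (measurableTypeR R) n @^-1` (tuple_scale c @^-1` A)) =
            phi @^-1` (@pair_cons _ (measurableTypeR R) n @^-1` A).
  apply/funext => -[x t]; congr (A _); exact/val_inj.
rewrite !tE phiE -nuE; apply/esym.
apply: product_measure_unique => [X Y mX mY|].
- rewrite nuE.
  rewrite (_ : phi @^-1` _ = ( *%R c @^-1` X) `*` (@tuple_scale R c n @^-1` Y))//.
  rewrite product_measure1E//.
  + rewrite exprS EFinM -muleA [X in (_ * X)%E]muleCA muleA lebesgue_measure_scale//.
    by rewrite IH.
  + rewrite -[X in measurable X]setTI.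
    have mc : measurable_fun setT ( *%R c : measurableTypeR R -> measurableTypeR R).
      exact: measurable_funM.
    exact: mc.
  + by rewrite -[X in measurable X]setTI; exact: measurable_tuple_scale.
- by rewrite -[X in measurable X]setTI; exact: measurable_pair_cons.
Qed.

(** * Measurability and finiteness of volumes of sets of row vectors *)

(** Links the topology of row vectors to the product sigma-algebra of tuples: an open set is the
    union of the countably many rational boxes it contains. *)
Lemma measurable_open_rV (R : realType) n (A : set 'rV[R]_n) : open A ->
  measurable ([set t | A (\row_k tnth t k)] : set (n.-tuple (measurableTypeR R))).
Proof.
move=> oA.
pose box (c : 'rV[rat]_n * 'rV[rat]_n) : set 'rV[R]_n :=
  [set v | forall i, v 0 i \in `]ratr (c.1 0 i), ratr (c.2 0 i)[].
have -> : ([set t | A (\row_k tnth t k)] : set (n.-tuple (measurableTypeR R))) =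
   \bigcup_(c in [set c | box c `<=` A]) [set t | box c (\row_k tnth t k)].
  apply/seteqP; split => [t At|t [c cA]]; last exact: cA.
  have [v vE] : exists v : 'rV[R]_n, v = \row_k tnth t k by exists (\row_k tnth t k).
  rewrite /= -vE in At.
  have /nbhs_ballP[e /= e0 veA] : nbhs v A by exact: open_nbhs_nbhs (conj oA At).
  (* Rational endpoints within [e] of each coordinate keep the box inside the ball, since balls of
     row vectors are taken coordinatewise. *)
  have lo i : exists q : rat, ratr q \in `]v 0 i - e, v 0 i[.
    by apply: rat_in_itvoo; rewrite ltrBlDr ltrDl.
  have hi i : exists q : rat, ratr q \in `]v 0 i, v 0 i + e[.
    by apply: rat_in_itvoo; rewrite ltrDl.
  have [a aP] := choice lo; have [b bP] := choice hi.
  exists (\row_i a i, \row_i b i) => /=; last first.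
    move=> i; rewrite -vE !mxE in_itv/=.
    by move: (aP i) (bP i); rewrite !in_itv/= => /andP[_ ->] /andP[->].
  move=> w wb; apply: veA; split => // i j; rewrite (ord1 i) /ball/= => {i}.
  move: (wb j) (aP j) (bP j); rewrite !mxE !in_itv/= => /andP[aw wb'] /andP[ea _] /andP[_ be].
  rewrite ltr_distl.
  rewrite !ltrBlDr (lt_trans wb' be)/= in ea *.
  by rewrite (lt_trans ea)// ltrD2r.
rewrite bigcup_mkcond.
apply: countable_bigcupT_measurable => [|c]; first exact: countableP.
case: ifPn => // _.
rewrite (_ : [set _ | _] = \bigcap_(i in [set: 'I_n])
  ((fun t : n.-tuple (measurableTypeR R) => tnth t i) @^-1`
     `]ratr (c.1 0 i), ratr (c.2 0 i)[%classic)).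
  apply: fin_bigcap_measurable => [|i _]; first exact: finite_finset.
  rewrite -[X in measurable X]setTI.
  apply: measurable_tnth => //; exact: measurable_itv.
apply/seteqP; split => t /= h i => [_|].
  by have := h i; rewrite mxE.
by rewrite mxE; exact: h.
Qed.

Definition rV_measurable {R : realType} {n} (A : set 'rV[R]_n) :=
  measurable ([set t | A (\row_k tnth t k)] : set (n.-tuple (measurableTypeR R))).

Lemma closed_rV_measurable {R : realType} n (A : set 'rV[R]_n) :
  closed A -> rV_measurable A.
Proof.
move=> cA; rewrite /rV_measurable -[X in measurable X]setCK; apply: measurableC.
by apply: (@measurable_open_rV R n (~` A)); exact: closed_openC.
Qed.

Lemma lebesgue_rV0 {R : realType} n : lebesgue_rV (set0 : set 'rV[R]_n) = 0%E.
Proof. exact: measure0. Qed.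

Lemma lebesgue_rV_ge0 {R : realType} n (A : set 'rV[R]_n) :
  (0 <= lebesgue_rV A)%E.
Proof. exact: measure_ge0. Qed.

Lemma le_lebesgue_rV {R : realType} n (A B : set 'rV[R]_n) :
  rV_measurable A -> rV_measurable B -> A `<=` B ->
  (lebesgue_rV A <= lebesgue_rV B)%E.
Proof.
move=> mA mB AB; apply: le_measure; rewrite ?inE// => t; exact: AB.
Qed.

Lemma lebesgue_rV_scale {R : realType} n (c : R) (A : set 'rV[R]_n) :
  0 < c -> rV_measurable A ->
  lebesgue_rV A = ((c ^+ n)%:E * lebesgue_rV [set v | A (c *: v)%R])%E.
Proof.
move=> c0 mA; rewrite /lebesgue_rV -(tuple_lebesgue_scale c n _ c0 mA).
congr (_ * tuple_measure _ _ _)%E; apply/funext => t /=; congr (A _).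
by apply/rowP => i; rewrite !mxE tnth_map.
Qed.

Lemma rV_measurable_cube {R : realType} n (B : R) :
  rV_measurable [set v : 'rV[R]_n | forall i, `|v 0 i| <= B].
Proof.
apply: closed_rV_measurable.
rewrite (_ : mkset _ = \bigcap_(i in [set: 'I_n]) [set v : 'rV[R]_n | `|v 0 i| <= B]).
  apply: closed_bigI => i _.
  apply: (@closed_comp _ _ (fun v : 'rV[R]_n => `|v 0 i|) [set x | x <= B]).
    move=> v _; apply: continuous_comp; first exact: coord_continuous.
    exact: norm_continuous.
  exact: closed_le.
by apply/seteqP; split => v h i => [_|]; exact: h.
Qed.

(** The enclosing cube is a box, so its volume is a finite product of interval lengths. *)
Lemma lebesgue_rV_bounded {R : realType} n (A : set 'rV[R]_n) (B : R) :
  rV_measurable A -> (forall v, A v -> forall i, `|v 0 i| <= B) ->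
  lebesgue_rV A \is a fin_num.
Proof.
move=> mA AB.
rewrite ge0_fin_numE ?lebesgue_rV_ge0//.
apply: (@le_lt_trans _ _ (lebesgue_rV [set v : 'rV[R]_n | forall i, `|v 0 i| <= B])).
  by apply: le_lebesgue_rV => //; exact: rV_measurable_cube.
rewrite -ge0_fin_numE ?lebesgue_rV_ge0// /lebesgue_rV.
pose I (_ : 'I_n) : set (measurableTypeR R) := (`[- B, B]%classic : set R).
rewrite (_ : [set t | _] =
  [set t : n.-tuple (measurableTypeR R) | forall i, I i (tnth t i)]).
  rewrite (@tuple_measure_box _ _ R lebesgue_measure n I).
    apply: prode_fin_num => i _.
    suff : lebesgue_measure (`[- B, B]%classic : set R) \is a fin_num by [].
    by rewrite lebesgue_measure_itv/=; case: ifP.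
  by move=> i; exact: measurable_itv.
by apply/seteqP; split => t h i; have := h i; rewrite /I /= in_itv/= mxE ler_norml.
Qed.

(** * Continuity and compactness for functions of a row vector *)

Lemma cvg_mx_coord {K : numFieldType} {T : Type} {F : set_system T} {FF : Filter F}
    m n (f : T -> 'M[K]_(m, n)) (M : 'M[K]_(m, n)) :
  (forall i j, f x i j @[x --> F] --> M i j) -> f x @[x --> F] --> M.
Proof.
move=> fM A [P nP PA]; rewrite nbhs_simpl /=.
have : \forall x \near F, forall i j, P i j (f x i j).
  apply: filter_forall => i; apply: filter_forall => j; exact: (fM i j _ (nP i j)).
by apply: filterS => x; exact: PA.
Qed.

(** The constant is the minimum of [H] on the unit sphere; homogeneity extends the bound to all
    vectors. *)
Lemma homogeneous_lower_bound {R : realType} m (H : 'rV[R]_m -> R) :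
  continuous H -> (forall v, 0 <= H v) -> (forall v, H v = 0 -> v = 0) ->
  (forall (t : R) v, H (t *: v) = `|t| * H v) ->
  exists2 c : R, 0 < c & forall v, c * `|v| <= H v.
Proof.
move=> cH H0 Heq HZ.
pose S : set 'rV[R]_m := [set v | `|v| = 1].
have norm_unit v : v != 0 -> S (`|v|^-1 *: v).
  by move=> v0; rewrite /S/= normrZ normfV normr_id mulVf// normr_eq0.
(* An empty sphere leaves only the zero vector, and then any positive constant works. *)
have [S0|S0] := pselect (S !=set0); last first.
  exists 1 => // v; have [->|v0] := eqVneq v 0; first by rewrite normr0 mulr0.
  by exfalso; apply: S0; exists (`|v|^-1 *: v); exact: norm_unit.
have cS : compact S.
  apply: bounded_closed_compact.
    exists 1; split => // x x1 v /= ->; exact: ltW.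
  apply: (@closed_comp _ _ (fun v : 'rV[R]_m => `|v|) [set x | x = 1]).
    by move=> v _; exact: norm_continuous.
  exact: closed_eq.
have [v0 /set_mem v0S minH] := compact_EVT_min S0 cS (continuous_subspaceT cH).
exists (H v0).
  rewrite lt_neqAle H0 andbT eq_sym; apply/eqP => /Heq v00.
  by move: v0S; rewrite /S/= v00 normr0 => /esym/eqP; rewrite oner_eq0.
move=> v; have [->|vn0] := eqVneq v 0; first by rewrite normr0 mulr0.
have nv : 0 < `|v| by rewrite normr_gt0.
rewrite -ler_pdivlMr// mulrC -[X in X * _]ger0_norm ?invr_ge0// -HZ.
by apply: minH; rewrite inE; exact: norm_unit.
Qed.

(** Joint convergence near each [(a, +oo)] becomes uniform over the cube because a compact set has
    the near-covering property. *)
Lemma near_row_mx_inv {R : realType} n (H : 'rV[R]_(1 + n) -> R) (B d : R) :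
  continuous H -> 0 < d ->
  \forall x \near +oo, forall a : 'rV[R]_n, (forall i, `|a 0 i| <= B) ->
    `|H (row_mx (const_mx x^-1) a) - H (row_mx (const_mx 0) a)| < d.
Proof.
move=> cH d0.
have cK : compact [set v : 'rV[R]_n | forall i, `[- B, B]%classic (v 0 i)].
  apply: (@rV_compact _ _ (fun=> `[- B, B]%classic)) => _.
  exact: segment_compact.
have /compact_near_coveringP cov := cK.
have near_cov := cov _ (nbhs +oo) (fun x a =>
  `|H (row_mx (const_mx x^-1) a) - H (row_mx (const_mx 0) a)| < d) _.
apply: filterS (near_cov _ _) => [x h a aB|].
  by apply: h => i /=; rewrite in_itv/= -ler_norml.
move=> a _.
(* Applied to [u] the inverse of the second component and to [u] zero: both terms of the difference
   have the same limit. *)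
have cvH (u : 'rV[R]_n * R -> R) :
    u p @[p --> (nbhs a, nbhs +oo)] --> (0 : R) ->
    H (row_mx (const_mx (u p)) p.1) @[p --> (nbhs a, nbhs +oo)]
      --> H (row_mx (const_mx 0) a).
  move=> u0; apply: continuous_cvg; first exact: cH.
  apply: cvg_mx_coord => i j; rewrite (ord1 i); case: (split_ordP j) => k ->.
    have -> : (fun p => row_mx (const_mx (u p) : 'rV_1) p.1 0 (lshift n k)) = u.
      by apply/funext => p; rewrite row_mxEl mxE.
    by rewrite row_mxEl mxE.
  have -> : (fun p : 'rV[R]_n * R => row_mx (const_mx (u p) : 'rV_1) p.1 0 (rshift 1 k))
            = (fun p => p.1 0 k) by apply/funext => p; rewrite row_mxEr.
  rewrite row_mxEr.
  apply: (@cvg_comp _ _ _ fst (fun b : 'rV[R]_n => b 0 k)); first exact: cvg_fst.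
  exact: coord_continuous.
have inv0 : p.2^-1 @[p --> (nbhs a, nbhs (+oo : set_system R))] --> (0 : R).
  apply: (@cvg_comp _ _ _ snd (fun x : R => x^-1)); first exact: cvg_snd.
  apply/gtr0_cvgV0; last exact: cvg_id.
  exact: nbhs_pinfty_gt.
have := cvgB (cvH _ inv0) (cvH _ (cvg_cst _)).
rewrite subrr => lim0; exact: (cvgr0_norm_lt _ (lim0 _ _) _ d0).
Qed.

(** * Volumes of the sublevel sets of a homogeneous function on an affine slice *)

Section homogeneous_volume.
Context {R : realType} {n : nat}.
Variable H : 'rV[R]_(1 + n) -> R.
Hypothesis cH : continuous H.
Hypothesis H_ge0 : forall v, 0 <= H v.
Hypothesis H_eq0 : forall v, H v = 0 -> v = 0.
Hypothesis HZ : forall (t : R) v, H (t *: v) = `|t| * H v.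

(** The leading coefficient [s] is 1 for monic polynomials, 0 for the star body, and [x^-1] once a
    monic polynomial has been divided by [x]. *)
Let G (s : R) (b : 'rV[R]_n) := H (row_mx (const_mx s) b).
Let V (x : R) := lebesgue_rV [set b | G 1 b <= x].
Let U := [set b | G 0 b <= 1].

Let GZ t s b : 0 <= t -> G (t * s) (t *: b) = t * G s b.
Proof.
move=> t0; rewrite /G -[in RHS](ger0_norm t0) -HZ scale_row_mx.
by congr (H (row_mx _ _)); apply/rowP => i; rewrite !mxE.
Qed.

Let cG s : continuous (G s).
Proof.
move=> b; apply: (@continuous_comp _ _ _
  (fun b : 'rV[R]_n => row_mx (const_mx s) b) H); last exact: cH.
have nF : Filter (nbhs b) by exact: nbhs_filter.
apply: (cvg_mx_coord (FF := nF)) => i j; rewrite (ord1 i); case: (split_ordP j) => k ->.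
  have -> : (fun b : 'rV[R]_n => row_mx (const_mx s : 'rV_1) b 0 (lshift n k)) = cst s.
    by apply/funext => ?; rewrite row_mxEl mxE.
  by rewrite row_mxEl mxE; exact: cvg_cst.
have -> : (fun b : 'rV[R]_n => row_mx (const_mx s : 'rV_1) b 0 (rshift 1 k))
          = (fun b => b 0 k) by apply/funext => ?; rewrite row_mxEr.
by rewrite row_mxEr; exact: coord_continuous.
Qed.

Let measurable_sublevel s x : rV_measurable [set b | G s b <= x].
Proof.
apply: closed_rV_measurable.
apply: (@closed_comp _ _ (G s) [set y | y <= x]); last exact: closed_le.
by move=> v _; exact: cG.
Qed.

Let coord_le_norm m (v : 'rV[R]_m) i : `|v 0 i| <= `|v|.
Proof.
rewrite [leRHS]/Num.Def.normr /= mx_normrE.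
exact: (le_bigmax _ (fun ij : 'I_1 * 'I_m => `|v ij.1 ij.2|) (0, i)).
Qed.

(** The norm is the largest coordinate in modulus. The bound by [s] empties the small monic sublevel
    sets; the bound by the entries of [b] makes sublevel sets bounded. *)
Let G_bound : exists2 c, 0 < c &
  forall s b, c * `|s| <= G s b /\ (forall i, c * `|b 0 i| <= G s b).
Proof.
have [c c0 cP] := @homogeneous_lower_bound R (1 + n) H cH H_ge0 H_eq0 HZ.
exists c => // s b; split=> [|i]; apply: le_trans (cP _); rewrite ler_pM2l//.
  by have := coord_le_norm _ (row_mx (const_mx s : 'rV_1) b) (lshift n 0); rewrite row_mxEl mxE.
by have := coord_le_norm _ (row_mx (const_mx s : 'rV_1) b) (rshift 1 i); rewrite row_mxEr.
Qed.

Lemma volume_eq0 : exists2 eps : R, 0 < eps & forall x, x < eps -> V x = 0%E.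
Proof.
have [c c0 cP] := G_bound.
exists c => // x xc; rewrite /V (_ : [set _ | _] = set0) ?lebesgue_rV0//.
apply/seteqP; split => // b /= Gx; have [+ _] := cP 1 b.
by rewrite normr1 mulr1 leNgt (le_lt_trans Gx xc).
Qed.

(** The bound [c^-1] is independent of [s], so a single cube serves the whole family. *)
Let bounded_sublevel : exists B, forall s b, G s b <= 1 -> forall i, `|b 0 i| <= B.
Proof.
have [c c0 cP] := G_bound.
exists c^-1 => s b Gb i; have [_ /(_ i) cb] := cP s b.
by rewrite -[c^-1]mulr1 mulrC ler_pdivlMr// mulrC (le_trans cb).
Qed.

Let sublevel_fin s : lebesgue_rV [set b | G s b <= 1] \is a fin_num.
Proof.
have [B GB] := bounded_sublevel.
by apply: (@lebesgue_rV_bounded R n _ B) => // b; exact: GB.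
Qed.

Let volumeE x : 0 < x ->
  V x = ((x ^+ n)%:E * lebesgue_rV [set b | (G x^-1 b <= 1)%R])%E.
Proof.
move=> x0; rewrite /V (lebesgue_rV_scale n x)//.
congr (_ * lebesgue_rV _)%E; apply/funext => b /=; congr is_true.
rewrite -[X in G X](mulfV (lt0r_neq0 x0)) GZ; last exact: ltW.
by rewrite -ler_pdivlMl// mulVf// gt_eqF.
Qed.

Let volume_divE x : 0 < x ->
  (V x / (x ^+ n)%:E)%E = lebesgue_rV [set b | G x^-1 b <= 1].
Proof.
move=> x0; rewrite volumeE// inver.
have xn0 : x ^+ n != 0 by rewrite expf_neq0// gt_eqF.
(* The extended inverse has a special value at 0, excluded here; finiteness of the volume moves the
   cancellation into [R]. *)
rewrite (negbTE xn0) -(fineK (sublevel_fin x^-1)) -!EFinM.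
by rewrite mulrAC divff// mul1r.
Qed.

Let scale_sublevel t : 0 < t ->
  lebesgue_rV [set b | G 0 b <= t] = ((t ^+ n)%:E * lebesgue_rV U)%E.
Proof.
move=> t0; rewrite (lebesgue_rV_scale n t)//.
congr (_ * lebesgue_rV _)%E; apply/funext => b /=; congr is_true.
rewrite -[X in G X](mulr0 t) GZ; last exact: ltW.
by rewrite mulr0 -ler_pdivlMl// mulVf// gt_eqF.
Qed.

Let near_sandwich d : 0 < d -> d < 1 -> \forall x \near +oo,
  (((1 - d) ^+ n)%:E * lebesgue_rV U <= lebesgue_rV [set b | (G x^-1 b <= 1)%R]
     <= ((1 + d) ^+ n)%:E * lebesgue_rV U)%E.
Proof.
move=> d0 d1; have [B GB] := bounded_sublevel.
apply: filterS (@near_row_mx_inv R n H B d cH d0) => x.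
rewrite -/(G _ _) => xP.
have {}xP (b : 'rV_n) : (forall i, `|b 0 i| <= B) -> G 0 b - d < G x^-1 b < G 0 b + d.
  by rewrite -ltr_distl; exact: xP.
(* Both bounds become volumes of sublevel sets of [G 0], at levels [1 - d] and [1 + d], so set
   inclusions suffice. In each inclusion the hypothesis on [b] first places it in the cube where the
   uniform estimate holds. *)
rewrite -!scale_sublevel ?subr_gt0 ?addr_gt0//; apply/andP; split.
  apply: le_lebesgue_rV => // b /= Gb.
  have /andP[_] : G 0 b - d < G x^-1 b < G 0 b + d.
    by apply/xP/(GB 0); apply: le_trans Gb _; rewrite gerBl ltW.
  by move: Gb; lra.
apply: le_lebesgue_rV => // b /= Gb.
have /andP[+ _] := xP b (GB _ b Gb).
by move: Gb; lra.
Qed.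

Lemma cvg_volume : (V x / (x ^+ n)%:E)%E @[x --> +oo] --> lebesgue_rV U.
Proof.
have UE := fineK (sublevel_fin 0); rewrite -/U in UE; rewrite -UE.
set L := fine _.
have xpos : \forall x \near +oo, (0 : R) < x by exact: nbhs_pinfty_gt.
apply: cvg_EFin.
  by apply: filterS xpos => x x0; rewrite volume_divE.
apply/cvgrPdist_le => e e0.
(* Continuity at 0, used at [d] and at [- d], brings both ends of the sandwich within [e] of [L]. *)
have cpow : (1 + d) ^+ n * L @[d --> (0 : R)] --> (1 + 0) ^+ n * L.
  apply: cvgMl; apply: (@cvg_comp _ _ _ (+%R 1) (fun x : R => x ^+ n)).
    by apply: cvgD; [exact: cvg_cst|exact: cvg_id].
  exact: exprn_continuous.
rewrite addr0 expr1n mul1r in cpow.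
have /cvgrPdist_le/(_ _ e0)/nbhs_ballP[r /= r0 rP] := cpow.
(* Halving [r] puts [d] strictly inside the ball; the cap [1 / 2] ensures [d < 1], as the sandwich
   requires. *)
pose d := Num.min (r / 2) (1 / 2).
have d0 : 0 < d by rewrite lt_min !divr_gt0.
have d1 : d < 1 by rewrite gt_min; apply/orP; right; lra.
have dr : d < r by rewrite gt_min; apply/orP; left; lra.
have := rP d; have := rP (- d).
rewrite /ball/= !sub0r !normrN gtr0_norm// => /(_ dr) lo /(_ dr) hi.
apply: filterS2 xpos (near_sandwich d d0 d1) => x x0.
rewrite /= volume_divE// -UE -(fineK (sublevel_fin x^-1)) -!EFinM !lee_fin -/L.
move: lo hi; rewrite !ler_distl.
set s := fine _; rewrite [fine s%:E]/=; lra.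
Qed.

(** The upper half of the sandwich at the arbitrary choice [d = 1 / 2]. *)
Lemma volume_bigO : exists C : R, \forall x \near +oo, (V x <= (C * x ^+ n)%:E)%E.
Proof.
exists ((1 + 1 / 2) ^+ n * fine (lebesgue_rV U)).
have xpos : \forall x \near +oo, (0 : R) < x by exact: nbhs_pinfty_gt.
have h0 : 0 < 1 / 2 :> R by lra.
have h1 : 1 / 2 < 1 :> R by lra.
apply: filterS2 xpos (near_sandwich _ h0 h1) => x x0 /andP[_ hi].
rewrite volumeE// mulrC EFinM EFinM fineK; last exact: sublevel_fin.
by rewrite lee_wpmul2l// lee_fin exprn_ge0// ltW.
Qed.

End homogeneous_volume.

Local Open Scope complex_scope.

(** * Coefficient vectors and their polynomials *)

Lemma real_complex_continuous {R : realType} :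
  continuous (real_complex R : R -> (R[i] : numFieldType)).
Proof.
move=> x; apply/cvgrPdist_lt => e e0.
(* In the order on [R[i]] a positive element has zero imaginary part. *)
have [r r0 ->] : exists2 r : R, 0 < r & e = r%:C.
  by case: e e0 => a b; rewrite ltcE /= => /andP[/eqP -> a0]; exists a.
near=> y; rewrite -rmorphB /= normc_def/= expr0n/= addr0 sqrtr_sqr ltcR.
near: y; exact: cvgr_dist_lt.
Unshelve. all: by end_near. Qed.

Lemma coef_poly_of_coefs {R : realType} M (c : 'rV[R[i]]_M.+1) (k : 'I_M.+1) :
  (poly_of_coefs c)`_(M - k) = c 0 k.
Proof.
rewrite coef_sum (bigD1 k)//= coefZ coefXn eqxx mulr1 big1 ?addr0// => j jk.
rewrite coefZ coefXn; case: eqP => [E|]; last by rewrite mulr0.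
case/negP: jk; apply/eqP/val_inj => /=.
(* Truncated subtraction from [M] is injective only on indices at most [M]. *)
have := ltn_ord j; have := ltn_ord k; rewrite !ltnS => kM jM.
by rewrite -(subKn jM) -E subKn.
Qed.

Lemma poly_of_coefs_eq0 {R : realType} M (c : 'rV[R[i]]_M.+1) :
  poly_of_coefs c = 0 -> c = 0.
Proof. by move=> c0; apply/rowP => k; rewrite -coef_poly_of_coefs c0 coef0 mxE. Qed.

Lemma poly_of_coefsZ {R : realType} M w (c : 'rV[R[i]]_M.+1) :
  poly_of_coefs (w *: c) = w *: poly_of_coefs c.
Proof.
by rewrite /poly_of_coefs scaler_sumr; apply: eq_bigr => k _; rewrite mxE scalerA.
Qed.

(** Exhibits monic polynomials and polynomials of lower degree as the slices [s = 1] and [s = 0] of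
    one coefficient space. *)
Lemma poly_of_coefs_row_mx {R : realType} N (s : 'rV[R[i]]_1) (b : 'rV[R[i]]_N) :
  poly_of_coefs (row_mx s b : 'rV_N.+1) =
  s 0 0 *: 'X^N + \sum_(k < N) b 0 k *: 'X^(N - k.+1).
Proof.
rewrite /poly_of_coefs big_ord_recl subn0; congr (_ *: _ + _).
  by rewrite -(row_mxEl s b); congr (row_mx s b 0 _); apply/val_inj.
apply: eq_bigr => k _; congr (_ *: _).
by rewrite -(row_mxEr s b); congr (row_mx s b 0 _); apply/val_inj.
Qed.

(** * The distance function on a real form of the coefficient space *)

Section real_subspace.
Context {R : realType} {Phi : {poly R[i]} -> R}.
Hypothesis hPhi : mult_distance_function Phi.
(** [L] will be [complex_rV] in the real case and [complex_split] in the complex one; the section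
    derives the hypotheses of [homogeneous_volume] for both. *)
Variables (m M : nat) (L : 'rV[R]_m -> 'rV[R[i]]_M.+1).
Hypothesis cL : forall i, continuous (fun v => L v 0 i : (R[i] : numFieldType)).
Hypothesis LZ : forall (t : R) v, L (t *: v) = t%:C *: L v.
Hypothesis L_eq0 : forall v, L v = 0 -> v = 0.

Let H v := Phi (poly_of_coefs (L v)).

Lemma Phi_coefs_continuous : continuous H.
Proof.
move=> v.
apply: (@continuous_comp _ _ _ (L : 'rV[R]_m -> 'rV[(R[i] : numFieldType)]_M.+1)
  (fun c => Phi (poly_of_coefs c))).
  have nF : Filter (nbhs v) by exact: nbhs_filter.
  by apply: (cvg_mx_coord (FF := nF)) => i j; rewrite (ord1 i); exact: cL.
exact: (@mdf_continuous _ _ hPhi M.+1 (fun k => 'X^(M - k)) (L v)).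
Qed.

Lemma Phi_coefs_ge0 v : 0 <= H v. Proof. exact: mdf_ge0. Qed.

Lemma Phi_coefs_eq0 v : H v = 0 -> v = 0.
Proof. by move=> /(mdf_eq0 hPhi) /poly_of_coefs_eq0 /L_eq0. Qed.

Lemma Phi_coefsZ (t : R) v : H (t *: v) = `|t| * H v.
Proof.
rewrite /H LZ poly_of_coefsZ (mdf_scale hPhi); congr (_ * _).
by rewrite /= expr0n/= addr0 sqrtr_sqr.
Qed.
End real_subspace.

Lemma complex_rV_eq0 {R : realType} n (v : 'rV[R]_n) : complex_rV v = 0 -> v = 0.
Proof.
move=> /rowP v0; apply/rowP => i; have := v0 i.
by rewrite !mxE => /eqP; rewrite fmorph_eq0 => /eqP.
Qed.

Definition complex_of_real_parts {R : realType} {n} (x : 'rV[R]_(n + n)) : 'rV[R[i]]_n :=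
  \row_k (lsubmx x 0 k +i* rsubmx x 0 k).

(** The leading coefficient stays real, which suffices for the values 1, 0 and [x^-1]. The other
    coefficients take [n + n] real coordinates, ordered as in [lebesgue_crV]. *)
Definition complex_split {R : realType} {n} (v : 'rV[R]_(1 + (n + n))) : 'rV[R[i]]_(1 + n) :=
  row_mx (complex_rV (lsubmx v)) (complex_of_real_parts (rsubmx v)).

Lemma complex_split_continuous {R : realType} n i :
  continuous (fun v : 'rV[R]_(1 + (n + n)) => complex_split v 0 i : (R[i] : numFieldType)).
Proof.
have cRC j : continuous (fun v : 'rV[R]_(1 + (n + n)) => (v 0 j)%:C : (R[i] : numFieldType)).
  move=> v; apply: (@continuous_comp _ _ _ (fun v : 'rV[R]_(1 + (n + n)) => v 0 j)).
    exact: coord_continuous.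
  exact: real_complex_continuous.
rewrite /complex_split.
case: (split_ordP i) => k ->.
  have -> : (fun v : 'rV[R]_(1 + (n + n)) => row_mx (complex_rV (lsubmx v))
      (complex_of_real_parts (rsubmx v)) 0 (lshift n k)) = (fun v => (v 0 (lshift _ k))%:C).
    by apply/funext => u; rewrite row_mxEl !mxE.
  exact: cRC.
(* Writing the entry as a sum of embedded reals, one multiplied by ['i], reduces continuity to that
   of the embedding. *)
have -> : (fun v : 'rV[R]_(1 + (n + n)) => row_mx (complex_rV (lsubmx v))
    (complex_of_real_parts (rsubmx v)) 0 (rshift 1 k)) =
  (fun v => (v 0 (rshift 1 (lshift n k)))%:C + 'i * (v 0 (rshift 1 (rshift n k)))%:C).
  apply/funext => u; rewrite row_mxEr !mxE; exact: complexE.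
move=> v; have nF : Filter (nbhs v) by exact: nbhs_filter.
apply: (cvgD (FF := nF)); first exact: cRC.
by apply: (cvgM (FF := nF)); [exact: cvg_cst|exact: cRC].
Qed.

Lemma complex_splitZ {R : realType} n (t : R) (v : 'rV[R]_(1 + (n + n))) :
  complex_split (t *: v) = t%:C *: complex_split v.
Proof.
rewrite /complex_split [RHS]scale_row_mx.
congr row_mx; apply/rowP => i; rewrite !mxE /= ?rmorphM//.
by apply/eqP; rewrite eq_complex /= !mul0r subr0 addr0 !eqxx.
Qed.

Lemma complex_split_eq0 {R : realType} n (v : 'rV[R]_(1 + (n + n))) :
  complex_split v = 0 -> v = 0.
Proof.
rewrite -[0]row_mx0 => /eq_row_mx[/complex_rV_eq0 v1 /rowP v2].
rewrite -[v]hsubmxK v1 -[rsubmx v]hsubmxK.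
have -> : lsubmx (rsubmx v) = 0.
  by apply/rowP => k; have := v2 k; rewrite !mxE => -[].
have -> : rsubmx (rsubmx v) = 0.
  by apply/rowP => k; have := v2 k; rewrite !mxE => -[].
by rewrite !row_mx0.
Qed.

(** * The real and the complex case as instances of the homogeneous one *)

Theorem theorem4 (R : realType) (Phi : {poly R[i]} -> R) (N : nat)
    (hPhi : mult_distance_function Phi) (hN : (1 <= N)%N) :
  (exists2 eps : R, 0 < eps &
     forall xi : R, 0 <= xi < eps ->
       vol_real Phi N xi = 0%E /\ vol_complex Phi N xi = 0%E) /\
  (exists C : R, \forall xi \near +oo,
     (vol_real Phi N xi <= (C * xi ^+ N)%:E)%E) /\
  (exists C : R, \forall xi \near +oo,
     (vol_complex Phi N xi <= (C * xi ^+ (2 * N))%:E)%E) /\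
  (vol_real Phi N xi / (xi ^+ N)%:E)%E @[xi --> +oo]
    --> lebesgue_rV (star_body_real Phi N.-1) /\
  (vol_complex Phi N xi / (xi ^+ (2 * N))%:E)%E @[xi --> +oo]
    --> lebesgue_crV (star_body_complex Phi N.-1).
Proof.
case: N hN => // N _.
(* Only the entry of [s] is prescribed, because the leading row appears as the complex image of a
   constant real row. *)
have monicE (b : 'rV[R[i]]_N.+1) (s : 'rV[R[i]]_1) : s 0 0 = 1 ->
    monic_of_coefs b = poly_of_coefs (row_mx s b : 'rV_N.+2).
  by move=> s1; rewrite poly_of_coefs_row_mx s1 scale1r.
have starE (a : 'rV[R[i]]_N.+1) (s : 'rV[R[i]]_1) : s 0 0 = 0 ->
    poly_of_coefs a = poly_of_coefs (row_mx s a : 'rV_N.+2).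
  move=> s0; rewrite poly_of_coefs_row_mx s0 scale0r add0r.
  by apply: eq_bigr => k _; rewrite subSS.
pose HR (v : 'rV[R]_(1 + N.+1)) := Phi (poly_of_coefs (complex_rV v : 'rV_N.+2)).
pose HC (v : 'rV[R]_(1 + (N.+1 + N.+1))) := Phi (poly_of_coefs (complex_split v)).
have volR xi : vol_real Phi N.+1 xi =
    lebesgue_rV [set b | HR (row_mx (const_mx 1) b) <= xi].
  congr lebesgue_rV; apply/funext => b /=; rewrite /monic_restr /HR /complex_rV.
  by rewrite map_row_mx -monicE// !mxE.
have starR : star_body_real Phi N = [set b | HR (row_mx (const_mx 0) b) <= 1].
  apply/funext => b /=; rewrite /HR /complex_rV.
  by rewrite map_row_mx -starE// !mxE.
have volC xi : vol_complex Phi N.+1 xi =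
    lebesgue_rV [set b | HC (row_mx (const_mx 1) b) <= xi].
  congr lebesgue_rV; apply/funext => b /=; rewrite /monic_restr /HC /complex_split.
  by rewrite row_mxKl row_mxKr -monicE// !mxE.
have starC : lebesgue_crV (star_body_complex Phi N) =
    lebesgue_rV [set b | HC (row_mx (const_mx 0) b) <= 1].
  congr lebesgue_rV; apply/funext => b /=; rewrite /HC /complex_split.
  by rewrite row_mxKl row_mxKr -starE// !mxE.
have cR i : continuous (fun v : 'rV[R]_(1 + N.+1) => complex_rV v 0 i : (R[i] : numFieldType)).
  move=> v; have -> : (fun v : 'rV[R]_(1 + N.+1) => complex_rV v 0 i) = (fun v => (v 0 i)%:C).
    by apply/funext => u; rewrite mxE.
  apply: (@continuous_comp _ _ _ (fun v : 'rV[R]_(1 + N.+1) => v 0 i)).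
    exact: coord_continuous.
  exact: real_complex_continuous.
have ZR (t : R) (v : 'rV[R]_(1 + N.+1)) : complex_rV (t *: v) = t%:C *: complex_rV v.
  exact: map_mxZ.
have R1 : continuous HR := Phi_coefs_continuous hPhi _ _ _ cR.
have R2 v : 0 <= HR v := Phi_coefs_ge0 hPhi _ _ _ v.
have R3 v : HR v = 0 -> v = 0 := Phi_coefs_eq0 hPhi _ _ _ (@complex_rV_eq0 R _) v.
have R4 (t : R) v : HR (t *: v) = `|t| * HR v := Phi_coefsZ hPhi _ _ _ ZR t v.
have C1 : continuous HC := Phi_coefs_continuous hPhi _ _ _ (@complex_split_continuous R _).
have C2 v : 0 <= HC v := Phi_coefs_ge0 hPhi _ _ _ v.
have C3 v : HC v = 0 -> v = 0 := Phi_coefs_eq0 hPhi _ _ _ (@complex_split_eq0 R _) v.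
have C4 (t : R) v : HC (t *: v) = `|t| * HC v := Phi_coefsZ hPhi _ _ _ (@complex_splitZ R _) t v.
have [e e0 eP] := volume_eq0 HR R1 R2 R3 R4.
have [e' e0' eP'] := volume_eq0 HC C1 C2 C3 C4.
split.
  exists (Num.min e e') => [|xi /andP[_]]; first by rewrite lt_min e0.
  by rewrite lt_min volR volC => /andP[/eP -> /eP' ->].
(* The exponent [2 * N] must read as the real dimension [N + N] of the split coordinates. *)
rewrite mul2n -addnn starR starC (funext volR) (funext volC).
split; first exact: (volume_bigO HR R1 R2 R3 R4).
split; first exact: (volume_bigO HC C1 C2 C3 C4).
split; first exact: (cvg_volume HR R1 R2 R3 R4).
exact: (cvg_volume HC C1 C2 C3 C4).
Qed.
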